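(* Let $\mathbf{a},\mathbf{d}$ be weak compositions of length $n$ and $N=\mathrm{rk}(\mathbf{d})-\mathrm{rk}(\mathbf{a})$. If $\mathbf{a}=\mathbf{a}^{(0)}\prec\!\!\!\cdot\,\mathbf{a}^{(1)}\prec\!\!\!\cdot\,\cdots\prec\!\!\!\cdot\,\mathbf{a}^{(N)}=\mathbf{d}$ is a saturated chain in the key poset, then the filling of the skew key diagram $\mathbf{d}/\mathbf{a}$ obtained by placing $N-i+1$ into the unique cell of $\mathbf{a}^{(i)}/\mathbf{a}^{(i-1)}$ is a standard skew key tableau. Conversely, given $T\in\mathrm{SKT}(\mathbf{d}/\mathbf{a})$ with $N$ cells, setting $\mathbf{a}^{(0)}=\mathbf{a}$ and, for $i=1,\dots,N$, letting $\mathbf{a}^{(i)}$ be the diagram consisting of the cells of $\mathbf{a}$ together with the cells of $T$ labeled $N,N-1,\dots,N-i+1$ yields a saturated chain from $\mathbf{a}$ to $\mathbf{d}$ in the key poset.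
   Context: A weak composition of length $n$ is $\mathbf{a}=(a_1,\dots,a_n)$ with $a_i\in\mathbb{Z}_{\ge0}$; $\mathrm{rk}(\mathbf{a})=\sum a_i$. Its key diagram is the set of cells $(r,c)$ with $1\le c\le a_r$ (row $r$ from the bottom, left-justified). For $\mathbf{a}\subseteq\mathbf{d}$ (componentwise $\le$), the skew key diagram $\mathbf{d}/\mathbf{a}$ is the set of cells of $\mathbf{d}$ not in $\mathbf{a}$. Key poset: $\mathbf{a}\preceq\mathbf{d}$ iff $a_i\le d_i$ for all $i$ and for all $i<j$ with $d_j>a_j$ and $a_i>a_j$ we have $d_i>d_j$. A saturated chain is a sequence of successive cover relations $p_0\prec\!\!\!\cdot\,\cdots\prec\!\!\!\cdot\, p_N$ ($q$ covers $p$ if $p\prec q$ with nothing strictly between). A standard skew key tableau of shape $\mathbf{d}/\mathbf{a}$ is a bijective filling of the cells of $\mathbf{d}/\mathbf{a}$ with $1,\dots,N$ such that entries decrease left to right along rows, and whenever an entry $i$ lies above (same column, higher row) an entry $k$ with $i<k$, there is an entry $j$ in the cell immediately right of $k$ and $i<j$. $\mathrm{SKT}(\mathbf{d}/\mathbf{a})$ is the set of these.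
   Formalization: In the column condition for standard skew key tableaux, the cells of a count as filled with infinity; with entries only in d/a the converse fails, e.g. a=(1,0), d=(2,1) with 2 in row 2 and 1 in row 1. *)

(* Defs.v *)
From mathcomp Require Import all_boot.

Set Implicit Arguments.
Unset Strict Implicit.
Unset Printing Implicit Defensive.

Definition wcomp (n : nat) := {ffun 'I_n -> nat}.

Definition rk n (a : wcomp n) : nat := \sum_(i < n) a i.

Definition wcomp_sub n (a d : wcomp n) : Prop := forall i, a i <= d i.

(** A cell is a pair (r, c): the row r counts from the bottom and is 0-based,
    the column c is 1-based, so that row r of the diagram of [a] occupies
    the columns 1, ..., a r. *)
Definition cell (n : nat) : Type := ('I_n * nat)%type.

Definition key_diagram n (a : wcomp n) : pred (cell n) :=
  [pred x | 1 <= x.2 <= a x.1].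

Definition skew_diagram n (d a : wcomp n) : pred (cell n) :=
  [pred x | (x \in key_diagram d) && (x \notin key_diagram a)].

Definition key_le n (a d : wcomp n) : Prop :=
  wcomp_sub a d /\
  forall i j : 'I_n, i < j -> a j < d j -> a j < a i -> d j < d i.

Definition key_lt n (a d : wcomp n) : Prop := key_le a d /\ a <> d.

Definition key_covers n (p q : wcomp n) : Prop :=
  key_lt p q /\ ~ (exists r, key_lt p r /\ key_lt r q).

(** Only the values p 0, ..., p N matter. *)
Definition saturated_chain n (N : nat) (p : nat -> wcomp n) : Prop :=
  forall i, i < N -> key_covers (p i) (p i.+1).

(** A filling of the skew diagram d/a is represented by a total function on
    cells; all the notions below depend only on its values on d/a. *)
Definition filling (n : nat) : Type := cell n -> nat.

(** The entry of a cell of [d] in a skew filling of shape d/a: the cells of the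
    removed diagram [a] count as filled with infinity, i.e. with a value larger
    than every label 1, ..., rk d - rk a.  This convention matters: without it,
    for a = (1,0) and d = (2,1), the filling that puts the label 2 in row 2 and
    the label 1 in row 1 would be admitted, although adding the cell of row 2
    first gives (1,1), which is not above (1,0) in the key poset. *)
Definition entry n (d a : wcomp n) (T : filling n) (x : cell n) : nat :=
  if x \in key_diagram a then (rk d - rk a).+1 else T x.

Definition bijective_filling n (d a : wcomp n) (T : filling n) : Prop :=
  [/\ forall x, x \in skew_diagram d a -> 1 <= T x <= rk d - rk a,
      {in skew_diagram d a &, injective T}
    & forall k, 1 <= k <= rk d - rk a ->
        exists2 x, x \in skew_diagram d a & T x = k].

Definition rows_decrease n (d a : wcomp n) (T : filling n) : Prop :=
  forall (r : 'I_n) (c c' : nat),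
    (r, c) \in skew_diagram d a -> (r, c') \in skew_diagram d a ->
    c < c' -> T (r, c') < T (r, c).

Definition key_condition n (d a : wcomp n) (T : filling n) : Prop :=
  forall (r s : 'I_n) (c : nat), r < s ->
    (r, c) \in key_diagram d -> (s, c) \in key_diagram d ->
    entry d a T (s, c) < entry d a T (r, c) ->
    (r, c.+1) \in key_diagram d /\
    entry d a T (s, c) < entry d a T (r, c.+1).

Definition is_SKT n (d a : wcomp n) (T : filling n) : Prop :=
  [/\ wcomp_sub a d, bijective_filling d a T,
      rows_decrease d a T & key_condition d a T].

(** [T] carries the label N - i + 1 in every cell of p i / p (i - 1). *)
Definition chain_filling n (N : nat) (p : nat -> wcomp n) (T : filling n) :
    Prop :=
  forall i, 1 <= i <= N -> forall x,
    x \in skew_diagram (p i) (p i.-1) -> T x = N - i + 1.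

(** For i <= N the composition p i is determined by its diagram: the cells of
    [a] and the cells of d/a labelled N, N - 1, ..., N - i + 1. *)
Definition filling_chain n (N : nat) (d a : wcomp n) (T : filling n)
    (p : nat -> wcomp n) : Prop :=
  forall i, i <= N -> forall x,
    x \in key_diagram (p i) <->
    x \in key_diagram a \/
    (x \in skew_diagram d a /\ N - i + 1 <= T x <= N).

(* Main.v *)
(** In a chain of length rk d - rk a every step adds exactly one cell, and adding
    a cell to row s of p goes up in the key poset iff no lower row of p has
    length p s + 1.  In terms of entries, a cell lies in p i iff its entry exceeds
    N - i.  So if (s, c) is the cell added to p i and (r, c) is an earlier cell
    below it, the condition on p says precisely that (r, c + 1) also comes
    earlier, which is the key condition on the filling. *)

Require Import Defs.
From mathcomp Require Import all_boot zify.

Set Implicit Arguments.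
Unset Strict Implicit.
Unset Printing Implicit Defensive.

Section KeyPoset.

Variable n : nat.
Implicit Types (a d p q : wcomp n) (r s : 'I_n) (x y : cell n) (T : filling n).

(** * Diagrams, ranks and the strict key order *)

Lemma mem_key_diagram p x : (x \in key_diagram p) = (0 < x.2 <= p x.1).
Proof. by []. Qed.

Lemma mem_skew_diagram d a x :
  (x \in skew_diagram d a) = (x \in key_diagram d) && (x \notin key_diagram a).
Proof. by []. Qed.

Lemma key_diagram_sub p q :
  wcomp_sub p q -> {subset key_diagram p <= key_diagram q}.
Proof.
move=> pq x; rewrite !mem_key_diagram => /andP[-> /leq_trans]; exact.
Qed.

Lemma key_diagram_inj p q : key_diagram p =i key_diagram q -> p = q.
Proof.
move=> pq; apply/ffunP => r; apply/eqP; rewrite eqn_leq.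
have := pq (r, p r); have := pq (r, q r); rewrite !mem_key_diagram /=.
lia.
Qed.

Lemma wcomp_sub_rk p q : wcomp_sub p q -> rk p <= rk q ?= iff (p == q).
Proof.
move=> pq; have [le eqr] :=
  leqif_sum (fun r (_ : true) => leqif_eq (pq r)).
split=> //; rewrite /rk eqr; apply/forallP/eqP => [h|-> r]; last exact: eqxx.
by apply/ffunP => r; apply/eqP/h.
Qed.

Lemma key_lt_rk p q : key_lt p q -> rk p < rk q.
Proof.
case=> -[/wcomp_sub_rk pq _] /eqP ne.
by rewrite ltn_neqAle pq.1 pq.2 ne.
Qed.

(** The rank is strictly increasing along [key_lt], so nothing fits between two consecutive
    ranks. *)
Lemma key_lt_covers p q : key_lt p q -> rk q = (rk p).+1 -> key_covers p q.
Proof.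
move=> pq rkq; split=> // -[r [/key_lt_rk pr /key_lt_rk]].
by rewrite rkq ltnS leqNgt pr.
Qed.

(** * Covers that add a single cell *)

Definition add_cell p s : wcomp n := [ffun r => p r + (r == s)].

Lemma rk_add_cell p s : rk (add_cell p s) = (rk p).+1.
Proof.
rewrite /rk (eq_bigr (fun r => p r + (r == s))) => [|r _]; last by rewrite ffunE.
by rewrite big_split /= -big_mkcond big_pred1_eq addn1.
Qed.

Lemma mem_add_cell p s x :
  (x \in key_diagram (add_cell p s)) =
  (x \in key_diagram p) || (x == (s, (p s).+1)).
Proof.
case: x => r c; rewrite !mem_key_diagram ffunE xpair_eqE /=.
by case: (eqVneq r s) => [->|_] /=; lia.
Qed.

Lemma mem_skew_add_cell p s x :
  (x \in skew_diagram (add_cell p s) p) = (x == (s, (p s).+1)).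
Proof.
rewrite mem_skew_diagram mem_add_cell.
case: eqVneq => [->|_]; last by rewrite orbF andbN.
by rewrite orbT mem_key_diagram /= ltnn.
Qed.

(** Some row [s] grows, since otherwise the ranks agree; then [add_cell p s] lies inside [q] and has
    the same rank. *)
Lemma wcomp_sub_rkS p q :
  wcomp_sub p q -> rk q = (rk p).+1 -> exists s, q = add_cell p s.
Proof.
move=> pq rkq; case: (pickP (fun s => p s < q s)) => [s lt_s|ge].
  exists s; apply/esym/eqP.
  have sub : wcomp_sub (add_cell p s) q.
    by move=> r; rewrite ffunE; have := pq r; case: eqP => [->|_]; lia.
  by rewrite -(wcomp_sub_rk sub).2 rk_add_cell rkq.
suff epq : p = q by move: rkq; rewrite epq; lia.
by apply/ffunP => r; apply/eqP; rewrite eqn_leq pq leqNgt ge.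
Qed.

(** Left-justification of [q] puts the first free cell of the row of [y] into [q], and the only new
    cell is [y]. *)
Lemma add_cell_of_diagram p q y :
  y \notin key_diagram p ->
  (forall x, (x \in key_diagram q) = (x \in key_diagram p) || (x == y)) ->
  y = (y.1, (p y.1).+1) /\ q = add_cell p y.1.
Proof.
case: y => s c /= yp eq_q.
have yE : (s, c) = (s, (p s).+1).
  have := eq_q (s, c); have := eq_q (s, (p s).+1); move: yp.
  by rewrite eqxx !mem_key_diagram !xpair_eqE eqxx /= => H1 H2 H3; congr pair; lia.
by split=> //; apply: key_diagram_inj => x; rewrite mem_add_cell eq_q yE.
Qed.

(** Only row [s] grows, so the key condition bears on [j = s] alone: [p s < p r] must survive as
    [(p s).+1 < p r], which fails exactly at equality. *)
Lemma key_le_add_cell p s :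
  key_le p (add_cell p s) <-> forall r, r < s -> p r != (p s).+1.
Proof.
split=> [[_ h] r rs|h].
  by have := h r s rs; rewrite !ffunE eqxx -val_eqE /= (ltn_eqF rs); lia.
split=> [r|r s']; first by rewrite ffunE leq_addr.
rewrite !ffunE; case: (eqVneq s' s) => [->|_]; last by rewrite addn0 ltnn.
by move=> rs; have := h r rs; rewrite -[r == s]val_eqE /= (ltn_eqF rs); lia.
Qed.

Lemma key_covers_add_cell p s :
  (forall r, r < s -> p r != (p s).+1) -> key_covers p (add_cell p s).
Proof.
move=> /key_le_add_cell le_ps; apply: key_lt_covers; last exact: rk_add_cell.
by split=> // /(congr1 (@rk n)); rewrite rk_add_cell; lia.
Qed.

(** * From a saturated chain to a tableau *)

Section Chain.

Variables (N : nat) (p : nat -> wcomp n).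
Hypothesis chain_p : saturated_chain N p.

Lemma chain_rk_gap i j : i <= j <= N -> rk (p i) + (j - i) <= rk (p j).
Proof.
case/andP=> ij; rewrite -(subnKC ij) addKn.
elim: (j - i) => [|k IHk] ikN; first by rewrite !addn0.
have [lt_k _] : key_covers (p (i + k)) (p (i + k).+1) by apply: chain_p; lia.
by have := key_lt_rk lt_k; have := IHk ltac:(lia); rewrite !addnS; lia.
Qed.

Lemma chain_mono i j :
  i <= j <= N -> {subset key_diagram (p i) <= key_diagram (p j)}.
Proof.
case/andP=> ij; rewrite -(subnKC ij).
elim: (j - i) => [|k IHk] ikN x; first by rewrite addn0.
move=> /(IHk ltac:(lia)); rewrite addnS; apply: key_diagram_sub.
by have [[[]]] := chain_p (i := i + k) ltac:(lia).
Qed.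

Lemma chain_filling_exists : exists T, chain_filling N p T.
Proof.
(* The label counts the members of the chain that contain [x]: a cell entering at step [i] lies in
   [p i], ..., [p N], which are [N - i + 1] of them. *)
exists (fun x => \sum_(j < N.+1) (x \in key_diagram (p j))) => i iN x.
rewrite mem_skew_diagram => /andP[xi xi'].
rewrite (eq_bigr (fun j : 'I_N.+1 => if i <= j then 1 else 0)) => [|j _].
  rewrite -(big_mkord xpredT (fun j => if i <= j then 1 else 0)).
  rewrite (@big_cat_nat _ _ _ i) /=; [|lia..].
  rewrite big_nat big1 => [|j]; last by case: (leqP i j); lia.
  rewrite big_nat (eq_bigr (fun=> 1)) => [|j]; last by case: (leqP i j); lia.
  by rewrite -big_nat sum_nat_const_nat; lia.
have jN := ltn_ord j.
case: (leqP i j) => ij; first by rewrite (@chain_mono i _ _ x xi) ?ij.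
by rewrite [x \in _](contraNF _ xi') //; apply: chain_mono; lia.
Qed.

Variables a d : wcomp n.
Hypotheses (rkN : N = rk d - rk a) (p0 : p 0 = a) (pN : p N = d).

(** Each step raises the rank by at least one, and [N] steps share a total rise of [N], so each
    raises it by exactly one. *)
Lemma chain_step i :
  i < N -> exists2 s, p i.+1 = add_cell (p i) s &
                      forall r, r < s -> p i r != (p i s).+1.
Proof.
move=> iN; have [[le_i _] _] := chain_p iN.
have rkS : rk (p i.+1) = (rk (p i)).+1.
  have := @chain_rk_gap 0 i; have := @chain_rk_gap i i.+1.
  by have := @chain_rk_gap i.+1 N; rewrite p0 pN; lia.
have [s pS] := wcomp_sub_rkS le_i.1 rkS.
by exists s => //; apply/key_le_add_cell; rewrite -pS.
Qed.

Lemma chain_skew_cell i :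
  1 <= i <= N -> exists! x, x \in skew_diagram (p i) (p i.-1).
Proof.
case: i => // i /chain_step[s -> _] /=.
exists (s, (p i s).+1); split=> [|x]; first by rewrite mem_skew_add_cell.
by rewrite mem_skew_add_cell => /eqP.
Qed.

Lemma chain_time x :
  x \in skew_diagram d a ->
  exists i, [/\ 1 <= i <= N, x \in skew_diagram (p i) (p i.-1) &
    forall j, j <= N -> (x \in key_diagram (p j)) = (i <= j)].
Proof.
rewrite mem_skew_diagram -p0 -pN => /andP[xd xa].
have [i xi min_i] := ex_minnP (ex_intro (fun i => x \in key_diagram (p i)) N xd).
have iN := min_i _ xd.
have i_gt0 : 0 < i by rewrite lt0n; apply: contraNneq xa => <-.
have xE j : j <= N -> (x \in key_diagram (p j)) = (i <= j).
  move=> jN; apply/idP/idP => [/min_i //|ij].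
  by apply: (@chain_mono i) xi; rewrite ij.
by exists i; split; rewrite ?i_gt0 // mem_skew_diagram !xE //; lia.
Qed.

Section Filling.

Variable T : filling n.
Hypothesis T_p : chain_filling N p T.

Lemma chain_fillingE x :
  x \in skew_diagram d a ->
  1 <= T x <= N /\
  forall i, i <= N -> (x \in key_diagram (p i)) = (N - i < T x).
Proof.
move=> /chain_time[i0 [i0N xi0 xE]]; rewrite (T_p i0N xi0).
by split=> [|i iN]; [|rewrite xE //]; lia.
Qed.

(** Cells of [a] fit the same formula because their entry [N + 1] exceeds every threshold
    [N - i]. *)
Lemma chain_entryE i x :
  i <= N -> x \in key_diagram d ->
  (x \in key_diagram (p i)) = (N - i < entry d a T x).
Proof.
move=> iN xd; rewrite /entry -rkN; case: ifPn => xa.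
  by rewrite (@chain_mono 0) ?p0 //; lia.
by have [|_ ->] := @chain_fillingE x; rewrite // mem_skew_diagram xd.
Qed.

Lemma chain_filling_bijective : bijective_filling d a T.
Proof.
split; rewrite -?rkN.
- by move=> x /chain_fillingE[].
- move=> x y /chain_time[i [iN xi _]] /chain_time[j [jN yj _]].
  rewrite (T_p iN xi) (T_p jN yj) => eq_ij.
  have ij : i = j by lia.
  rewrite -{j jN eq_ij}ij in yj; have [z [_ z_uniq]] := chain_skew_cell iN.
  by rewrite -(z_uniq _ xi) -(z_uniq _ yj).
move=> k kN; have iN : 1 <= N - k + 1 <= N by lia.
have [x [xi _]] := chain_skew_cell iN.
exists x; last by rewrite (T_p iN xi); lia.
move: xi; rewrite !mem_skew_diagram -pN -p0 => /andP[xi xi'].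
rewrite (chain_mono _ xi) /=; last by lia.
by apply: contraNN xi'; apply: chain_mono; lia.
Qed.

Lemma chain_filling_SKT : is_SKT d a T.
Proof.
have a_sub_d : wcomp_sub a d.
  move=> r; have := @chain_mono 0 N ltac:(lia) (r, a r).
  by rewrite p0 pN !mem_key_diagram /=; lia.
split=> // [|r c c' xd yd cc'|r s c rs xd yd lt_entry].
- exact: chain_filling_bijective.
- have [Ty yE] := chain_fillingE yd; have [Tx xE] := chain_fillingE xd.
  have [_ T_inj _] := chain_filling_bijective.
  rewrite ltn_neqAle; apply/andP; split.
    by apply: contraTneq cc' => /(T_inj _ _ yd xd)[->]; rewrite ltnn.
  (* At the step where [(r, c')] enters, the cell [(r, c)] to its left is present too, so its label
     is at least as large. *)
  move: (xd) (xE (N - T (r, c')).+1) (yE (N - T (r, c')).+1).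
  by rewrite mem_skew_diagram !mem_key_diagram /=; lia.
(* A cell of [a] has the maximal entry [N + 1], so it cannot be the smaller of two. *)
have yda : (s, c) \in skew_diagram d a.
  rewrite mem_skew_diagram yd /=; apply/negP => ya; move: lt_entry.
  rewrite {1}/entry ya -rkN {1}/entry -rkN; case: ifPn => xa; first lia.
  by have [|] := @chain_fillingE (r, c); rewrite ?mem_skew_diagram ?xd //; lia.
have TyE : entry d a T (s, c) = T (s, c).
  by rewrite /entry ifN //; case/andP: yda.
have [[|i] [// iN yi _]] := chain_time yda.
have := T_p iN yi; rewrite -TyE => {}TyE.
have [s' pS low] := chain_step (i := i) ltac:(lia).
move: yi; rewrite pS mem_skew_add_cell xpair_eqE => /andP[/eqP ss' /eqP cE].
rewrite -{}ss' in cE low.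
(* The cell [(s, c)] enters at step [i.+1] with label [N - i], so the larger entry of [(r, c)] puts
   it in [p i]. Row [r] then has length at least [c], and [low] excludes equality. *)
have xi : (r, c) \in key_diagram (p i) by rewrite chain_entryE //; lia.
have zi : (r, c.+1) \in key_diagram (p i).
  by move: xi (low r rs); rewrite !mem_key_diagram /= cE; lia.
have zd : (r, c.+1) \in key_diagram d.
  by rewrite -pN; apply: chain_mono zi; lia.
by split=> //; move: zi; rewrite chain_entryE //; lia.
Qed.

End Filling.

End Chain.

(** * From a tableau to a saturated chain *)

Section Tableau.

Variables (a d : wcomp n) (T : filling n).
Hypothesis SKT_T : is_SKT d a T.
Let N := rk d - rk a.

Lemma label_bounds x :
  x \in key_diagram d -> x \notin key_diagram a -> 0 < T x <= N.
Proof.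
have [_ [T_bnd _ _] _ _] := SKT_T.
by move=> xd xa; apply: T_bnd; rewrite mem_skew_diagram xd.
Qed.

Lemma entry_gt0 x : x \in key_diagram d -> 0 < entry d a T x.
Proof.
by move=> xd; rewrite /entry; case: ifPn => // /(label_bounds xd)/andP[].
Qed.

Lemma entry_gt x :
  x \in key_diagram d -> (N < entry d a T x) = (x \in key_diagram a).
Proof.
move=> xd; rewrite /entry; case: ifPn => [_|/(label_bounds xd)/andP[_ le_x]].
  exact: leqnn.
by rewrite ltnNge le_x.
Qed.

(** The decrease is only weak, since all cells of [a] share the entry [N + 1]. *)
Lemma entry_row_anti r c c' :
  (r, c') \in key_diagram d -> 0 < c <= c' ->
  entry d a T (r, c') <= entry d a T (r, c).
Proof.
have [_ _ T_row _] := SKT_T.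
move=> yd /andP[c0]; rewrite leq_eqVlt => /predU1P[-> //|cc'].
have xd : (r, c) \in key_diagram d by move: yd; rewrite !mem_key_diagram /=; lia.
case: (boolP ((r, c) \in key_diagram a)) => xa.
  rewrite [leqRHS]/entry xa /entry; case: ifPn => // /(label_bounds yd)/andP[_].
  exact: leqW.
have ya : (r, c') \notin key_diagram a.
  by move: xa; rewrite !mem_key_diagram /=; lia.
rewrite /entry (negbTE xa) (negbTE ya) ltnW //.
by apply: T_row; rewrite // mem_skew_diagram ?xd ?yd.
Qed.

(** The length of a row is its last column with entry above [N - i]. The index [c = 0] is not a
    cell, but it contributes 0 to the maximum and is harmless. *)
Definition tableau_chain (i : nat) : wcomp n :=
  [ffun r => \max_(c < (d r).+1 | N - i < entry d a T (r, c : nat)) c].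

(** Entries weakly decrease along rows, so the cells above a threshold are left-justified and the
    last such column determines them. *)
Lemma mem_tableau_chain i x :
  (x \in key_diagram (tableau_chain i)) =
  (x \in key_diagram d) && (N - i < entry d a T x).
Proof.
case: x => r c; rewrite [LHS]mem_key_diagram ffunE /=.
apply/idP/idP => [/andP[c0 le_c]|/andP[xd lt_c]].
  case: (pickP (fun c' : 'I_(d r).+1 =>
           (N - i < entry d a T (r, c' : nat)) && (c <= c'))) => [c'|none].
    case/andP=> lt_c' cc'; have c'd := ltn_ord c'.
    have yd : (r, nat_of_ord c') \in key_diagram d.
      by rewrite mem_key_diagram /=; lia.
    rewrite (leq_trans lt_c') ?entry_row_anti ?c0 // mem_key_diagram /=.
    by lia.
  (* If no qualifying column is [c] or beyond, the maximum is below [c]. *)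
  case: c c0 le_c none => // c _ /[swap] none; rewrite leqNgt => /negP[].
  rewrite ltnS; apply/bigmax_leqP => c' lt_c'; have := none c'.
  by rewrite lt_c' /= => /negbT; rewrite -leqNgt.
move: (xd); rewrite mem_key_diagram /= => /andP[-> cd] /=.
by rewrite -ltnS in cd; apply: (bigmax_sup (Ordinal cd)).
Qed.

Lemma tableau_chain0 : tableau_chain 0 = a.
Proof.
have [a_sub_d _ _ _] := SKT_T.
apply: key_diagram_inj => x; rewrite mem_tableau_chain subn0.
case: (boolP (x \in key_diagram d)) => [/entry_gt //|].
by move=> xd; apply/esym/negbTE; apply: contraNN xd; apply: key_diagram_sub.
Qed.

Lemma tableau_chainN : tableau_chain N = d.
Proof.
apply: key_diagram_inj => x; rewrite mem_tableau_chain subnn.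
by apply: andb_idr => /entry_gt0.
Qed.

Lemma filling_tableau_chain : filling_chain N d a T tableau_chain.
Proof.
have [a_sub_d _ _ _] := SKT_T.
move=> i iN x; rewrite mem_tableau_chain /entry mem_skew_diagram addn1.
case: ifPn => xa; split.
- by left.
- by move=> _; rewrite (key_diagram_sub a_sub_d) //=; rewrite /N; lia.
- case/andP=> xd lt_x; right; rewrite xd lt_x /=; split=> //.
  by have /andP[] := label_bounds xd xa.
by case=> [//|[/andP[-> _] /andP[]]].
Qed.

Lemma saturated_tableau_chain : saturated_chain N tableau_chain.
Proof.
have [_ [_ T_inj T_surj] _ T_key] := SKT_T.
move=> i iN; have [|[s c] yda Ty] := T_surj (N - i); first by rewrite -/N; lia.
have /andP[yd ya] := yda.
have entry_y : entry d a T (s, c) = N - i by rewrite /entry ifN.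
(* Passing from threshold [N - i] to the next one admits just the entry [N - i], which occurs only
   at [(s, c)]. *)
have entryE x : x \in key_diagram d ->
    (entry d a T x == N - i) = (x == (s, c)).
  move=> xd; apply/eqP/eqP => [|->//]; rewrite /entry -/N.
  case: ifPn => xa; first lia.
  by rewrite -Ty; apply: T_inj; rewrite // mem_skew_diagram xd.
have yi : (s, c) \notin key_diagram (tableau_chain i).
  by rewrite mem_tableau_chain entry_y ltnn andbF.
have [x|[cE] ->] := @add_cell_of_diagram _ (tableau_chain i.+1) _ yi.
  rewrite !mem_tableau_chain; case: (boolP (x \in key_diagram d)) => xd /=.
    by rewrite -entryE //; lia.
  by apply/esym/negbTE; apply: contraNneq xd => ->.
(* Suppose a lower row [r] has length exactly [c]. Its last cell has an entry above that of
   [(s, c)], so the key condition puts [(r, c.+1)] in the diagram as well, a contradiction. *)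
apply: key_covers_add_cell => r /= rs; apply/negP; rewrite -cE => /eqP rc.
have c_gt0 : 0 < c by case/andP: yd.
have : (r, c) \in key_diagram (tableau_chain i).
  by rewrite mem_key_diagram /= rc c_gt0 /=.
rewrite mem_tableau_chain -entry_y => /andP[xd /(T_key _ _ _ rs xd yd)[zd lt_z]].
have : (r, c.+1) \in key_diagram (tableau_chain i).
  by rewrite mem_tableau_chain zd -entry_y.
by rewrite mem_key_diagram /= rc ltnn.
Qed.

End Tableau.

End KeyPoset.

Theorem theorem4p7 (n : nat) (a d : wcomp n) (N : nat)
    (hN : N = rk d - rk a) :
  (forall p : nat -> wcomp n,
     p 0 = a -> p N = d -> saturated_chain N p ->
     [/\ forall i, 1 <= i <= N ->
           exists! x, x \in skew_diagram (p i) (p i.-1),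
         exists T, chain_filling N p T
       & forall T, chain_filling N p T -> is_SKT d a T]) /\
  (forall T : filling n, is_SKT d a T ->
     exists p : nat -> wcomp n,
       [/\ filling_chain N d a T p, p 0 = a, p N = d
         & saturated_chain N p]).
Proof.
split=> [p p0 pN chain_p|T SKT_T].
  split=> [i iN||T T_p].
  - exact: (chain_skew_cell chain_p hN p0 pN iN).
  - exact: (chain_filling_exists chain_p).
  exact: (chain_filling_SKT chain_p hN p0 pN T_p).
rewrite hN; exists (tableau_chain a d T); split.
- exact: filling_tableau_chain.
- exact: tableau_chain0.
- exact: tableau_chainN.
exact: saturated_tableau_chain.
Qed.
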